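(* Let $G$ be a Garside group with positive monoid $G^+\neq\{1\}$ and Garside element $\Delta$. For every element $g\in G$, $$\textstyle\inf_s(g)\le t_{\inf}(g)<\inf_s(g)+1 .$$
   Context: Garside groups. Let $M$ be a monoid. An atom is an element $a\in M\setminus\{1\}$ such that $a=bc$ implies $b=1$ or $c=1$. For $a\in M$, $\|a\|$ is the supremum of the lengths of all expressions of $a$ as a product of atoms. $M$ is atomic if it is generated by its atoms and $\|a\|<\infty$ for all $a\in M$. In an atomic monoid, $a\le_L b$ means $ac=b$ for some $c\in M$, and $a\le_R b$ means $ca=b$ for some $c\in M$; these are partial orders. An atomic monoid $M$ is a Garside monoid if (i) $M$ is finitely generated; (ii) $M$ is left and right cancellative; (iii) $(M,\le_L)$ and $(M,\le_R)$ are lattices; (iv) there is an element $\Delta\in M$ (a Garside element) such that for each $a\in M$, $a\le_L\Delta$ if and only if $a\le_R\Delta$, and the set $\{a\in M: a\le_L\Delta\}$ generates $M$. A Garside monoid embeds in its group of fractions $G$, which is called a Garside group; $M$ is identified with its image in $G$, denoted $G^+$ and called the positive monoid. For $g,h\in G$, $g\le_L h$ means $gc=h$ for some $c\in G^+$. Invariants. For $g\in G$, $\inf(g)=\max\{r\in\mathbb Z:\Delta^r\le_L g\}$. Let $[g]=\{h^{-1}gh: h\in G\}$ be the conjugacy class and $\inf_s(g)=\max\{\inf(h):h\in[g]\}$. The asymptotic invariant is $t_{\inf}(g)=\lim_{n\to\infty}\inf(g^n)/n$ (this limit is known to exist for every $g\in G$). *)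

(* Defs.v *)
From HB Require Import structures.
From mathcomp Require Import all_boot all_order all_algebra.
From mathcomp Require Import all_classical all_reals all_analysis.

Set Implicit Arguments.
Unset Strict Implicit.
Unset Printing Implicit Defensive.

Import Order.TTheory GRing.Theory Num.Theory.
Import numFieldNormedType.Exports.

Local Open Scope classical_set_scope.
Local Open Scope group_scope.

Section Monoid.
Variable M : monoidType.
Implicit Types (a b c : M) (A : set M) (w : seq M) (le : M -> M -> Prop).

Definition word_in A w : Prop := forall x, x \in w -> A x.

Definition generates A : Prop :=
  forall a, exists2 w, word_in A w & a = \prod_(x <- w) x.

Definition finitely_generated : Prop :=
  exists s : seq M, generates [set x | x \in s].

Definition atom a : Prop :=
  a <> 1 /\ forall b c, a = b * c -> b = 1 \/ c = 1.

Definition atom_lengths a : set nat :=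
  [set size w | w in [set w | word_in atom w /\ a = \prod_(x <- w) x]].

(* The norm of [a] is the supremum of [atom_lengths a] in the natural numbers
   extended with infinity; it is finite when this set is bounded above. *)
Definition finite_norm a : Prop := has_ubound (atom_lengths a).

Definition atomic : Prop := generates atom /\ forall a, finite_norm a.

Definition leL a b : Prop := exists c, a * c = b.

Definition leR a b : Prop := exists c, c * a = b.

Definition is_meet le a b m : Prop :=
  [/\ le m a, le m b & forall c, le c a -> le c b -> le c m].

Definition is_join le a b j : Prop :=
  [/\ le a j, le b j & forall c, le a c -> le b c -> le j c].

Definition is_partial_order le : Prop :=
  [/\ forall a, le a a,
      forall a b, le a b -> le b a -> a = b
    & forall a b c, le a b -> le b c -> le a c].

Definition is_lattice le : Prop :=
  [/\ is_partial_order le,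
      forall a b, exists m, is_meet le a b m
    & forall a b, exists j, is_join le a b j].

Definition left_cancellative : Prop := forall a b c, a * b = a * c -> b = c.

Definition right_cancellative : Prop := forall a b c, b * a = c * a -> b = c.

Definition garside_element (Delta : M) : Prop :=
  (forall a, leL a Delta <-> leR a Delta) /\
  generates [set a | leL a Delta].

Record garside_monoid : Prop := GarsideMonoid {
  garside_atomic : atomic;
  garside_fingen : finitely_generated;
  garside_cancelL : left_cancellative;
  garside_cancelR : right_cancellative;
  garside_latticeL : is_lattice leL;
  garside_latticeR : is_lattice leR;
  garside_elementP : exists Delta, garside_element Delta
}.

End Monoid.

(* [G], with the embedding [iota], is a group of fractions of [M]; these
   conditions determine [(G, iota)] up to a unique isomorphism when [M] is
   a Garside monoid.  The positive monoid of [G] is the image of [iota]. *)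
Record group_of_fractions (M : monoidType) (G : groupType) (iota : M -> G) :
    Prop := GroupOfFractions {
  fractions_morphism : monoid.monoid_morphism iota;
  fractions_inj : injective iota;
  fractions_surj : forall g, exists a b, g = iota a * (iota b)^-1
}.

Definition expgz (G : groupType) (g : G) (r : int) : G :=
  match r with Posz n => g ^+ n | Negz n => g ^- n.+1 end.

(* The maximum of a set of integers, with the junk value 0 if there is none. *)
Definition zmax (A : set int) : int :=
  xget 0%R [set r | A r /\ forall s, A s -> (s <= r)%R].

Section Invariants.
Variables (M : monoidType) (G : groupType) (iota : M -> G) (Delta : M).
Implicit Types g h : G.

Definition gleL g h : Prop := exists c : M, g * iota c = h.

Definition ginf g : int := zmax [set r | gleL (expgz (iota Delta) r) g].

Definition conj_class g : set G := [set h^-1 * g * h | h in [set: G]].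

Definition ginf_s g : int := zmax (ginf @` conj_class g).

Definition t_inf (R : realType) g : R :=
  limn (fun n : nat => ((ginf (g ^+ n))%:~R / n%:R)%R : R).

End Invariants.

(* Main.v *)
(** By superadditivity of [inf] along powers, [t_inf g] is the supremum of
    [inf (g ^+ n) / n], and it is constant on conjugacy classes; this gives the
    first inequality.  For the second one, suppose [t_inf g >= r + 1] with
    [r = inf_s g].  The map [T x = g * x * Delta ^ - (r + 1)] is an automorphism
    of the lattice [(G, <=_L)], and some conjugate of [g] has infimum at least
    [r + 1] if and only if [x <=_L T x] for some [x].  The hypothesis only gives
    [1 <=_L T^(n m) 1 * Delta ^ m] for suitable [m], for each [n]; taking joins
    over orbits removes the errors, since a strict chain in an interval
    [[x, x * Delta]] has length at most the norm of [Delta]. *)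
Require Import Defs.
From mathcomp Require Import all_boot all_order all_algebra.
From mathcomp Require Import all_classical all_reals all_analysis.
From mathcomp Require Import zify ring lra.

Set Implicit Arguments.
Unset Strict Implicit.
Unset Printing Implicit Defensive.

Import Order.TTheory GRing.Theory Num.Theory.
Import numFieldNormedType.Exports.

Local Open Scope classical_set_scope.
Local Open Scope group_scope.

(** * Superadditive real sequences *)

(** The defect [b n] of [a n] from the line of slope [a m / m] does not decrease from [n] to
    [n + m], so its values at the residues below [m] bound it from below. *)
Lemma superadditive_lower_bound (R : realType) (a : nat -> R) (m : nat) :
  (forall i j, a i + a j <= a (i + j)%N)%R -> (0 < m)%N ->
  exists K : R, forall n, (n%:R * (a m / m%:R) - K <= a n)%R.
Proof.
move=> superadd m_gt0; pose b n := (a n - n%:R * (a m / m%:R))%R.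
have b_m n : (b n <= b (n + m)%N)%R.
  have := superadd n m; rewrite /b natrD mulrDl.
  have -> : (m%:R * (a m / m%:R) = a m)%R by rewrite mulrC divfK ?pnatr_eq0 -?lt0n.
  lra.
exists (\sum_(i < m) `|b i|)%R => n.
suff: (- \sum_(i < m) `|b i| <= b n)%R by rewrite /b; lra.
elim/ltn_ind: n => n IHn; have [lt_nm|le_mn] := ltnP n m.
  have : (`|b n| <= \sum_(i < m) `|b i|)%R.
    by rewrite (bigD1 (Ordinal lt_nm)) //= lerDl sumr_ge0.
  have := lerNnormlW (lexx `|b n|%R); lra.
rewrite -(subnK le_mn); apply: le_trans (b_m _); apply: IHn; lia.
Qed.

(** The limit is the supremum of the quotients [a n / n], finite because of [C]; an almost optimal
    [m] controls all large [n] up to the error [K / n]. *)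
Lemma fekete (R : realType) (a : nat -> R) (C : R) :
  (forall i j, a i + a j <= a (i + j)%N)%R -> (forall n, a n <= n%:R * C)%R ->
  exists2 l : R, ((a n / n%:R)%R @[n --> \oo] --> l) &
    forall n, (a n <= n%:R * l)%R.
Proof.
move=> superadd leC; pose E := [set (a n / n%:R)%R | n in [set n | (0 < n)%N]].
have E_sup : has_sup E.
  split; first by exists (a 1%N / 1%:R)%R, 1%N.
  exists C => _ [n n_gt0 <-]; rewrite ler_pdivrMr ?ltr0n // mulrC; exact: leC.
exists (sup E); last first.
  case=> [|n]; first by have := leC 0%N; rewrite !mul0r.
  rewrite mulrC -ler_pdivrMr ?ltr0n //; apply: sup_upper_bound => //.
  by exists n.+1.
apply/cvgrPdist_lt => e e_gt0.
have [_ [m m_gt0 <-] lt_m] := sup_adherent (divr_gt0 e_gt0 (ltr0n R 2)) E_sup.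
have [K leK] := superadditive_lower_bound superadd m_gt0.
exists (Num.truncn (K / (e / 2))%R).+1 => // n /= le_n.
have n_gt0 : (0 < n)%N by exact: leq_ltn_trans le_n.
have n_gt0' : (0 < n%:R :> R)%R by rewrite ltr0n.
have ub_n : (a n / n%:R <= sup E)%R by apply: sup_upper_bound => //; exists n.
have lb_n : (a m / m%:R - K / n%:R <= a n / n%:R)%R.
  rewrite ler_pdivlMr // mulrBl divfK ?gt_eqF // mulrC; exact: leK.
have small : (K / n%:R < e / 2)%R.
  rewrite ltr_pdivrMr // mulrC -ltr_pdivrMr ?divr_gt0 //.
  by apply: lt_le_trans (truncnS_gt _) _; rewrite ler_nat.
by rewrite ger0_norm; lra.
Qed.

Lemma archimedean_le0 (R : realType) (d c : R) :
  (forall n : nat, n%:R * d <= c)%R -> (d <= 0)%R.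
Proof.
move=> le_c; rewrite leNgt; apply/negP => d_gt0.
have := le_c (Num.truncn (c / d)%R).+1.
by rewrite -ler_pdivlMr // leNgt truncnS_gt.
Qed.

(** * Integer powers and maxima of sets of integers *)

Section IntegerPowers.
Variable G : groupType.
Implicit Types (x y : G) (r s : int).

Lemma expgz_succ x r : expgz x (r + 1)%R = expgz x r * x.
Proof.
case: r => [n|[|n]].
- by rewrite -PoszD addn1 /= expgSr.
- by rewrite NegzE addNr /= mulVg.
- have ->: (Negz n.+1 + 1 = Negz n)%R by lia.
  by rewrite /= [x ^+ n.+2]expgS invgM mulgVK.
Qed.

Lemma expgzD x r s : expgz x (r + s)%R = expgz x r * expgz x s.
Proof.
have nonneg r' n : expgz x (r' + Posz n)%R = expgz x r' * x ^+ n.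
  elim: n => [|n IHn]; first by rewrite addr0 mulg1.
  by rewrite -addn1 PoszD addrA expgz_succ IHn addn1 expgSr mulgA.
case: s => [n|n]; first exact: nonneg.
apply: (mulIg (x ^+ n.+1)); rewrite -nonneg /= mulgVK.
by congr expgz; lia.
Qed.

Lemma expgzN x r : expgz x (- r)%R = (expgz x r)^-1.
Proof. by apply/esym/mulg1_eq; rewrite -expgzD subrr. Qed.

End IntegerPowers.

(** Ensures that [zmax] is not its default value. The induction is on a bound for the distance from
    a member [a] up to [b]. *)
Lemma zmaxP (A : set int) (b : int) :
  A !=set0 -> (forall r, A r -> (r <= b)%R) ->
  A (zmax A) /\ forall r, A r -> (r <= zmax A)%R.
Proof.
move=> [a Aa] leb.
suff mP : [set m | A m /\ forall s, A s -> (s <= m)%R] !=set0.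
  exact: (xgetPex 0%R mP).
have [n] : exists n : nat, (b - a <= n%:Z)%R by exists `|b - a|%N; lia.
elim: n a Aa => [|n IHn] a Aa le_n.
  by exists a; split=> // s /leb; lia.
have [[s [As lt_as]]|nA] := pselect (exists s, A s /\ (a < s)%R).
  by apply: (IHn s As); lia.
exists a; split=> // s As; rewrite leNgt; apply/negP => lt_as.
by apply: nA; exists s.
Qed.

(** * Factorizations and the Garside element in the monoid *)

Section GarsideMonoid.
Variable M : monoidType.
Implicit Types (a b c : M) (u w : seq M).

Lemma atomic_word_refine u : generates (@atom M) -> (forall x, x \in u -> x <> 1) ->
  exists w, [/\ word_in (@atom M) w, \prod_(x <- w) x = \prod_(x <- u) x
              & (size u <= size w)%N].
Proof.
move=> genM; elim: u => [|a u IHu] u1.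
  by exists [::]; split=> // x; rewrite in_nil.
have [w1 w1P eq_a] := genM a.
have [|w2 [w2P eq_u le_u]] := IHu.
  by move=> x xu; apply: u1; rewrite in_cons xu orbT.
exists (w1 ++ w2); split.
- by move=> x; rewrite mem_cat => /orP[]; [exact: w1P|exact: w2P].
- by rewrite big_cat big_cons eq_u -eq_a.
- rewrite size_cat /= -add1n leq_add //.
  case: w1 eq_a {w1P} => // a1; case: (u1 a); first exact: mem_head.
  by rewrite a1 big_nil.
Qed.

(** Splitting the letters of [u] and the cofactor [c] into atoms never shortens the word, so the
    norm of [a] serves as [B]. *)
Lemma factor_length_bounded a : atomic M ->
  exists B : nat, forall u c, (forall x, x \in u -> x <> 1) ->
    \prod_(x <- u) x * c = a -> (size u <= B)%N.
Proof.
move=> [genM normM]; have [B leB] := normM a; exists B => u c u1 eq_a.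
have [w [wP eq_u le_uw]] := atomic_word_refine genM u1.
have [v vP eq_c] := genM c.
have /leB : atom_lengths a (size (w ++ v)).
  exists (w ++ v) => //; split; last by rewrite big_cat /= eq_u -eq_c.
  by move=> x; rewrite mem_cat => /orP[]; [exact: wP|exact: vP].
by rewrite leEnat size_cat; lia.
Qed.

Lemma garside_unit a b : garside_monoid M -> a * b = 1 -> a = 1.
Proof.
move=> hM ab1; have [[_ anti _] _ _] := garside_latticeL hM.
by apply: anti; [exists b|exists a; rewrite mul1g].
Qed.

Lemma garside_element_neq1 (Delta : M) : garside_monoid M -> garside_element Delta ->
  (exists a : M, a <> 1) -> Delta <> 1.
Proof.
move=> hM [_ genD] [a a1] D1; apply: a1.
have [w wP ->] := genD a; elim: w wP => [|x w IHw] wP; first by rewrite big_nil.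
rewrite big_cons IHw ?mulg1 => [|y yw]; last by apply: wP; rewrite in_cons yw orbT.
have [b] := wP x (mem_head _ _); rewrite D1; exact: garside_unit.
Qed.

(** For a letter [x] dividing [Delta], write [Delta = x * y = y * z]; then
    [x * Delta = x * y * z = Delta * z]. *)
Lemma garside_pushR (Delta : M) a : garside_element Delta ->
  exists b, a * Delta = Delta * b.
Proof.
move=> [balanced genD]; have [w wP ->] := genD a.
elim: w wP => [|x w IHw] wP; first by exists 1; rewrite big_nil mul1g mulg1.
have [y xy] := wP x (mem_head _ _).
have [z yz] : leL y Delta by apply/balanced; exists x.
have [|b eq_b] := IHw; first by move=> v vw; apply: wP; rewrite in_cons vw orbT.
exists (z * b).
by rewrite big_cons -mulgA eq_b mulgA -[in LHS]yz !mulgA xy.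
Qed.

Lemma garside_pushL (Delta : M) a : garside_element Delta ->
  exists b, Delta * a = b * Delta.
Proof.
move=> [balanced genD]; have [w wP ->] := genD a.
elim: w wP => [|x w IHw] wP; first by exists 1; rewrite big_nil mul1g mulg1.
have [y yx] : leR x Delta by apply/balanced/wP; exact: mem_head.
have [z zy] : leR y Delta by apply/balanced; exists x.
have [|b eq_b] := IHw; first by move=> v vw; apply: wP; rewrite in_cons vw orbT.
exists (z * b).
by rewrite big_cons mulgA -[in LHS]zy -(mulgA z) yx -!mulgA eq_b.
Qed.

End GarsideMonoid.

(** * The lattice order on the group of fractions *)

Section GarsideGroup.
Variables (M : monoidType) (Delta : M) (G : groupType) (iota : M -> G).
Hypotheses (hM : garside_monoid M) (hDelta : garside_element Delta).
Hypotheses (hG : group_of_fractions iota) (hM1 : exists a : M, a <> 1).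
Implicit Types (a b c : M) (g h j x y z : G) (r s : int).

Local Notation D := (expgz (iota Delta)).
Local Notation "x <=L y" := (gleL iota x y) (at level 70).
Local Notation inf := (ginf iota Delta).

Lemma fractionsM a b : iota (a * b) = iota a * iota b.
Proof. by have [_ ->] := fractions_morphism hG. Qed.

Lemma fractions1 : iota 1 = 1.
Proof. by have [-> _] := fractions_morphism hG. Qed.

Lemma gleL_refl x : x <=L x.
Proof. by exists 1; rewrite fractions1 mulg1. Qed.

Lemma gleL_trans y x z : x <=L y -> y <=L z -> x <=L z.
Proof. by move=> [a <-] [b <-]; exists (a * b); rewrite fractionsM mulgA. Qed.

Lemma gleL_mul2l z x y : x <=L y -> z * x <=L z * y.
Proof. by move=> [a <-]; exists a; rewrite mulgA. Qed.

(** Conjugation by powers of [Delta] preserves the positive monoid; hence right multiplication by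
    them is monotone for the left order. *)
Lemma iota_expDelta a r : exists b, iota a * D r = D r * iota b.
Proof.
have right n c : exists b, iota c * iota Delta ^+ n = iota Delta ^+ n * iota b.
  elim: n c => [|n IHn] c; first by exists c; rewrite mul1g mulg1.
  have [d cd] := garside_pushR c hDelta; have [b db] := IHn d.
  by exists b; rewrite expgS mulgA -fractionsM cd fractionsM -!mulgA db.
have left n c : exists b, iota Delta ^+ n * iota c = iota b * iota Delta ^+ n.
  elim: n c => [|n IHn] c; first by exists c; rewrite mul1g mulg1.
  have [d cd] := garside_pushL c hDelta; have [b db] := IHn d.
  by exists b; rewrite expgSr -mulgA -fractionsM cd fractionsM !mulgA db.
case: r => n; first exact: right.
have [b ab] := left n.+1 a; exists b => /=.
by apply: (mulIg (iota Delta ^+ n.+1)); rewrite mulgVK -mulgA -ab mulKg.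
Qed.

Lemma gleL_mulDelta2r r x y : x <=L y -> x * D r <=L y * D r.
Proof.
by move=> [a <-]; have [b ab] := iota_expDelta a r; exists b; rewrite -!mulgA ab.
Qed.

Lemma gleL_mulDelta x r : (0 <= r)%R -> x <=L x * D r.
Proof.
case: r => // n _; elim: n => [|n IHn]; first by rewrite mulg1; exact: gleL_refl.
by apply: gleL_trans IHn _; exists Delta; rewrite /= expgSr mulgA.
Qed.

Lemma gleL_expDelta r s : (r <= s)%R -> D r <=L D s.
Proof.
move=> le_rs; have -> : s = (r + (s - r))%R by ring.
by rewrite expgzD; apply: gleL_mulDelta; rewrite subr_ge0.
Qed.

Lemma iota_gleL_expDelta a : exists n : nat, iota a <=L D n.
Proof.
have [w wP ->] := hDelta.2 a.
elim: w wP => [|x w IHw] wP.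
  by exists 0%N; rewrite big_nil fractions1; exact: gleL_refl.
have [|n le_n] := IHw; first by move=> v vw; apply: wP; rewrite in_cons vw orbT.
have [y xy] := wP x (mem_head _ _).
exists n.+1; rewrite big_cons fractionsM.
apply: gleL_trans (gleL_mul2l _ le_n) _.
have -> : D n.+1 = iota Delta * D n by exact: expgS.
by apply: gleL_mulDelta2r; exists y; rewrite -fractionsM xy.
Qed.

Lemma expDelta_gleL g : exists n : nat, D (- n%:Z)%R <=L g.
Proof.
have [a [b ->]] := fractions_surj hG g.
have [n [c bc]] := iota_gleL_expDelta b; exists n.
have [e eq_e] := iota_expDelta (a * c) (- n%:Z)%R; exists e.
by rewrite -eq_e fractionsM expgzN -bc invgM !mulgA mulgK.
Qed.

(** A common lower bound, a negative power of [Delta], translates [x] and [y] into the positive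
    monoid, where joins exist. *)
Lemma gleL_join x y : exists j, forall z, j <=L z <-> x <=L z /\ y <=L z.
Proof.
have [m le_m] := expDelta_gleL x; have [n le_n] := expDelta_gleL y.
have [a eq_x] : D (- (m + n)%:Z)%R <=L x.
  by apply: gleL_trans le_m; apply: gleL_expDelta; lia.
have [b eq_y] : D (- (m + n)%:Z)%R <=L y.
  by apply: gleL_trans le_n; apply: gleL_expDelta; lia.
have [_ _ /(_ a b)[j [[a' aj] [b' bj] jP]]] := garside_latticeL hM.
exists (D (- (m + n)%:Z)%R * iota j) => c; split=> [le_j|[[c1 xc] [c2 yc]]].
  split; apply: gleL_trans le_j; [exists a'; rewrite -aj|exists b'; rewrite -bj].
    by rewrite -eq_x fractionsM mulgA.
  by rewrite -eq_y fractionsM mulgA.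
have eq_ab : a * c1 = b * c2.
  apply: (fractions_inj hG); apply: (mulgI (D (- (m + n)%:Z)%R)).
  by rewrite !fractionsM !mulgA eq_x eq_y xc yc.
have [e je] : leL j (a * c1) by apply: jP; [exists c1|exists c2; rewrite eq_ab].
by exists e; rewrite -mulgA -fractionsM je fractionsM mulgA eq_x.
Qed.

Lemma gleL_bigjoin (f : nat -> G) n :
  exists j, forall z, j <=L z <-> forall i, (i <= n)%N -> f i <=L z.
Proof.
elim: n => [|n [j jP]].
  exists (f 0%N) => c; split=> [le_c i|]; last exact.
  by rewrite leqn0 => /eqP ->.
have [k kP] := gleL_join j (f n.+1); exists k => c.
rewrite kP jP; split=> [[le_n le_Sn] i|le_n].
  by rewrite leq_eqVlt => /predU1P[->|] //; exact: le_n.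
by split=> [i le_i|]; apply: le_n => //; exact: leqW.
Qed.

(** * Bounded chains, the infimum, and conjugates of large infimum *)

Lemma gleL_chain_stabilizes : exists N : nat, forall (f : nat -> G),
  (forall k, f k <=L f k.+1) -> f N <=L f 0%N * iota Delta ->
  exists2 k, (k < N)%N & f k.+1 = f k.
Proof.
have [B leB] := factor_length_bounded Delta (garside_atomic hM).
(* [B] bounds the length of words dividing [Delta]; a chain strict for [B.+1] steps would spell a
   longer one. *)
exists B.+1 => f f_mono [c eq_c]; apply: contrapT => f_strict.
have word n : (n <= B.+1)%N -> exists u : seq M,
    [/\ forall v : M, v \in u -> v <> 1, size u = n
      & f 0%N * iota (\prod_(v <- u) v) = f n].
  elim: n => [|n IHn] lt_n.
    by exists [::]; split=> //; rewrite big_nil fractions1 mulg1.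
  have [u [u1 size_u eq_u]] := IHn (ltnW lt_n).
  have [d eq_d] := f_mono n; exists (rcons u d); split.
  - move=> x; rewrite mem_rcons in_cons => /predU1P[->|]; last exact: u1.
    by move=> d1; apply: f_strict; exists n; rewrite // -eq_d d1 fractions1 mulg1.
  - by rewrite size_rcons size_u.
  - by rewrite -cats1 big_cat big_seq1 /= fractionsM mulgA eq_u.
have [u [u1 size_u eq_u]] := word _ (leqnn _).
suff /(leB u c u1) : \prod_(v <- u) v * c = Delta by rewrite size_u ltnn.
apply: (fractions_inj hG); apply: (mulgI (f 0%N)).
by rewrite fractionsM mulgA eq_u.
Qed.

(** If [g] is [Delta ^- n * a], then [D s <=L g] makes [Delta ^+ (s + n)] a left divisor of [a] when
    [s + n] is nonnegative. As [Delta <> 1], this bounds [s], so the maximum is attained. *)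
Lemma ginfP g r : D r <=L g <-> (r <= inf g)%R.
Proof.
have [n [a eq_g]] := expDelta_gleL g.
have [B leB] := factor_length_bounded a (garside_atomic hM).
have [|s|inf_le inf_max] := @zmaxP [set r | D r <=L g] (B%:Z - n%:Z)%R.
- by exists (- n%:Z)%R; exists a.
- move=> [c eq_c]; have [m def_m] : exists m : nat, (s + n%:Z)%R = m%:Z%R \/ (s + n%:Z < 0)%R.
    by exists `|(s + n%:Z)%R|%N; lia.
  case: def_m => [def_m|]; last by lia.
  suff: (m <= B)%N by lia.
  have := leB (nseq m Delta) c; rewrite size_nseq; apply.
    move=> x; rewrite mem_nseq => /andP[_ /eqP ->]; exact: garside_element_neq1.
  apply: (fractions_inj hG); apply: (mulgI (D (- n%:Z)%R)).
  rewrite eq_g -eq_c fractionsM mulgA; congr (_ * _).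
  have -> : iota (\prod_(x <- nseq m Delta) x) = D m.
    elim: m {def_m} => [|m IHm]; first by rewrite big_nil fractions1.
    by rewrite big_cons fractionsM IHm /= expgS.
  by rewrite -expgzD; congr expgz; lia.
split; first exact: inf_max.
by move/gleL_expDelta => le_r; apply: gleL_trans le_r inf_le.
Qed.

Lemma ginfM g h : (inf g + inf h <= inf (g * h))%R.
Proof.
apply/ginfP; rewrite expgzD; have /(gleL_mulDelta2r (inf h)) le_g : D (inf g) <=L g.
  exact/ginfP.
apply: gleL_trans le_g _; exact/gleL_mul2l/ginfP.
Qed.

(* The map [T 1] is an automorphism of the ordered set [G] that commutes with
   right multiplication by [Delta], and [R <= inf (x^-1 * g * x)] means
   [x <=L T 1 x].  Joins over orbits of [T] give successively [x] with
   [x <=L T N x * Delta], then [y] with [y <=L T k y * Delta] for all [k <= N],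
   and a chain between [T N y] and [T N y * Delta] that must stabilize. *)
Lemma ginf_conj_ge g (R : int) :
  (forall n : nat, (0 < n)%N -> exists2 m : nat, (0 < m)%N &
     (m%:Z * (n%:Z * R - 1) <= inf (g ^+ (n * m)))%R) ->
  exists x, (R <= inf (x^-1 * g * x))%R.
Proof.
move=> inf_large; pose T (i : nat) x := g ^+ i * x * D (- (i%:Z * R))%R.
have TD i (j : nat) x : T (i + j)%N x = T i (T j x).
  rewrite /T expgnDr -!mulgA -expgzD; congr (_ * (_ * (_ * D _))).
  by rewrite PoszD; ring.
have T_mono i x y : x <=L y -> T i x <=L T i y.
  by move=> le_xy; apply: gleL_mulDelta2r; apply: gleL_mul2l.
have T_Delta i x r : T i (x * D r) = T i x * D r.
  by rewrite /T -!mulgA -!expgzD addrC.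
have D1 : D 1%R = iota Delta by exact: expg1.
have [N chainP] := gleL_chain_stabilizes.
have N_gt0 : (0 < N)%N.
  have [k||k ltkN _] := chainP (fun=> 1).
  - exact: gleL_refl.
  - by rewrite -D1; exact: gleL_mulDelta.
  - exact: leq_ltn_trans ltkN.
have [x le_x] : exists x, x <=L T N x * D 1%R.
  have [m m_gt0 le_m] := inf_large N N_gt0.
  pose f i := T (N * i)%N 1 * D i.
  have fS i : f i.+1 = T N (f i) * D 1%R.
    rewrite /f mulnS TD (T_Delta N (T (N * i)%N 1)) -(mulgA (T N _)) -expgzD.
    by congr (_ * D _); lia.
  have [x xP] := gleL_bigjoin f m.-1; have ub_x := (xP x).1 (gleL_refl x).
  (* The map [T N] followed by [D 1] shifts [f i] to [f i.+1]. The orbit closes up because the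
     hypothesis on [m] says [f 0 <=L f m]. *)
  exists x; apply/xP => -[_|i lt_i].
    have: f m <=L T N x * D 1%R.
      by rewrite -(prednK m_gt0) fS; apply/gleL_mulDelta2r/T_mono/ub_x.
    apply: gleL_trans; rewrite /f /T muln0 mul0r oppr0 !mulg1.
    have /(ginfP (g ^+ (N * m))) := le_m.
    move=> /(gleL_mulDelta2r (- (m%:Z * (N%:Z * R - 1)))%R).
    rewrite -expgzD subrr; congr (_ <=L _).
    by rewrite -mulgA -expgzD PoszM; congr (_ * D _); ring.
  by rewrite fS; apply/gleL_mulDelta2r/T_mono/ub_x/ltnW.
have [y le_y] : exists y, forall k, (k <= N)%N -> y <=L T k y * D 1%R.
  have [y yP] := gleL_bigjoin (T^~ x) N.-1; have ub_y := (yP y).1 (gleL_refl y).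
  (* If [k <= i], then [T i x] is already below [T k y]. Otherwise [le_x] raises the index to
     [i + N] at the cost of one [Delta], and [i + N - k < N]. *)
  exists y => k le_k; apply/yP => i le_i; have [le_ki|lt_ik] := leqP k i.
    apply: gleL_trans (gleL_mulDelta _ _) => //.
    by rewrite -(subnKC le_ki) TD; apply/T_mono/ub_y; lia.
  apply: gleL_trans (T_mono i _ _ le_x) _; rewrite T_Delta -TD.
  have -> : (i + N = k + (i + N - k))%N by lia.
  by rewrite TD; apply/gleL_mulDelta2r/T_mono/ub_y; lia.
(* The chain starts at [T N y] and adjoins the terms of lower index one by one, down to [y]; by
   [le_y] it stays below [T N y * D 1]. *)
have [w wP] := choice (gleL_bigjoin (fun i => T (N - i)%N y)).
have ub_w k := (wP k (w k)).1 (gleL_refl (w k)).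
have [k||k lt_k eq_w] := chainP w.
- by apply/wP => i le_i; apply: ub_w; exact: leqW.
- rewrite -D1; apply/wP => i le_i.
  apply: (@gleL_trans (T N y * D 1%R)).
    rewrite -{2}(subnK le_i) TD -T_Delta; exact/T_mono/le_y.
  by apply: gleL_mulDelta2r; rewrite -{1}(subn0 N); exact: ub_w.
exists (w k); apply/ginfP.
(* Each term joined in [w k] is the image under [T 1] of a term joined in [w k.+1], which equals
   [w k]. *)
have: w k <=L T 1%N (w k).
  apply/wP => i le_i; have -> : (N - i = 1 + (N - i.+1))%N by lia.
  by rewrite TD -eq_w; exact/T_mono/ub_w.
move=> /(gleL_mulDelta2r R) /(gleL_mul2l (w k)^-1).
by rewrite /T expg1 mul1r mulKg -!mulgA -expgzD addNr mulg1.
Qed.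

(** * The asymptotic invariant *)

Lemma ginf1 : inf 1 = 0%R.
Proof.
have ge0 : (0 <= inf 1)%R by apply/ginfP; exact: gleL_refl.
by have := ginfM 1 1; rewrite mulg1; lia.
Qed.

Lemma ginfX g n : (n%:Z * inf g <= inf (g ^+ n))%R.
Proof.
elim: n => [|n IHn]; first by rewrite mul0r ginf1.
rewrite expgS; apply: le_trans (ginfM _ _).
by rewrite -add1n PoszD mulrDl mul1r lerD2l.
Qed.

Lemma t_infP (R : realType) g :
  (((inf (g ^+ n))%:~R / n%:R)%R @[n --> \oo] --> t_inf iota Delta R g) /\
  forall n, ((inf (g ^+ n))%:~R <= n%:R * t_inf iota Delta R g)%R.
Proof.
have [| |l cvg_l ub_l] :=
  @fekete R (fun n => (inf (g ^+ n))%:~R)%R (- (inf g^-1)%:~R)%R.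
- by move=> i k; rewrite -intrD ler_int expgnDr; exact: ginfM.
- move=> n; rewrite -mulrNz -[n%:R%R]/((n%:Z)%:~R)%R -intrM ler_int.
  (* The upper bound comes from [inf (g ^+ n) + inf (g ^- n) <= inf 1 = 0]. *)
  apply: (@le_trans _ _ (- inf (g^-1 ^+ n))%R); last by rewrite mulrN lerN2 ginfX.
  by rewrite -subr_le0 opprK -ginf1 -(mulgV (g ^+ n)) -expVgn ginfM.
by have -> : t_inf iota Delta R g = l by exact: cvg_lim.
Qed.

(** Passing from [h ^+ n] to [g ^+ n] lowers [inf] by at most a constant independent of [n], which
    disappears after division by [n]. *)
Lemma ginf_conj_le_t_inf (R : realType) g x :
  ((inf (x^-1 * g * x))%:~R <= t_inf iota Delta R g)%R.
Proof.
set h := x^-1 * g * x; have [_ ub] := t_infP R g.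
rewrite -subr_le0; apply: (@archimedean_le0 _ _ (- (inf x + inf x^-1)%:~R)%R) => n.
have eq_g : g ^+ n = x * h ^+ n * x^-1.
  have -> : h = g ^ x by rewrite /h conjgE mulgA.
  by rewrite -conjXg conjgE !mulgA mulgV mul1g mulgK.
have := ub n; have : (inf x + n%:Z * inf h + inf x^-1 <= inf (g ^+ n))%R.
  rewrite eq_g; apply: le_trans (ginfM _ _); rewrite lerD2r.
  by apply: le_trans (ginfM _ _); rewrite lerD2l ginfX.
by rewrite -(ler_int R) !intrD intrM; lra.
Qed.

End GarsideGroup.

Theorem theorem3p2 (R : realType) (M : monoidType) (Delta : M)
    (G : groupType) (iota : M -> G)
    (hM : garside_monoid M) (hDelta : garside_element Delta)
    (hG : group_of_fractions iota)
    (hM1 : exists a : M, a <> 1%g) (g : G) :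
  ((ginf_s iota Delta g)%:~R <= t_inf iota Delta R g)%R /\
  (t_inf iota Delta R g < (ginf_s iota Delta g)%:~R + 1)%R.
Proof.
set l := t_inf iota Delta R g.
have le_l x : ((ginf iota Delta (x^-1 * g * x)%g)%:~R <= l)%R.
  exact: ginf_conj_le_t_inf.
have [||[_ [x _ <-] eq_s] s_max] :=
  @zmaxP (ginf iota Delta @` conj_class g) (Num.ceil l).
- by exists (ginf iota Delta g), g => //; exists 1%g; rewrite ?invg1 ?mul1g ?mulg1.
- move=> _ [_ [x _ <-] <-]; rewrite -(ler_int R).
  exact: le_trans (le_l x) (ceil_ge _).
rewrite -/(ginf_s iota Delta g) in eq_s s_max.
split; first by rewrite -eq_s.
rewrite ltNge; apply/negP => ge_l.
have [n n_gt0|y] := @ginf_conj_ge _ _ _ _ hM hDelta hG hM1 g (ginf_s iota Delta g + 1)%R.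
  have [/cvgrPdist_lt cvg_l _] := t_infP hM hDelta hG hM1 R g.
  have n_gt0' : (0 < n%:R :> R)%R by rewrite ltr0n.
  (* An error below [1 / n] at the index [n * m] becomes, after multiplication by [n * m], an error
     below [m], as [ginf_conj_ge] allows. *)
  have [|k _ near_l] := cvg_l (n%:R^-1)%R; first by rewrite invr_gt0.
  exists k.+1 => //; set m := k.+1.
  have /= lt_l := near_l (n * m)%N (leq_trans (leqnSn k) (leq_pmull m n_gt0)).
  have nm_gt0 : (0 < (n * m)%:R :> R)%R by rewrite ltr0n muln_gt0 n_gt0.
  have := le_lt_trans (ler_norm _) lt_l; rewrite -/l ltrBlDl -ltrBlDr.
  have eq_m : (n%:R^-1 * (n * m)%:R = m%:R :> R)%R by rewrite natrM mulKf ?gt_eqF.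
  rewrite ltr_pdivlMr // mulrBl eq_m => lt_nm.
  apply/ltW; rewrite -(ltr_int R); apply: le_lt_trans lt_nm.
  have := ge_l; rewrite -(ler_pM2r nm_gt0) intrM intrB intrM intrD natrM.
  rewrite -![(Posz _)%:~R%R]/(_%:R)%R; lra.
rewrite lezD1 ltNge s_max //; exists (y^-1 * g * y)%g => //; by exists y.
Qed.
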